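(* Let $(\mathbf{X},Y)$ be a $(d+1)$-dimensional random vector, $\mathbf{X}=(X_1,\dots,X_d)$, with continuous univariate marginal distribution functions and connecting copula $A\in\mathcal{C}^{d+1}$. (i) The following statements are equivalent: (a) $Y$ is completely dependent on $\mathbf{X}$; (b) $\psi(A)=M$. (ii) The following statements are equivalent: (a) $Y$ and $\mathbf{X}$ are independent; (b) $\psi(A)=\Pi$; (c) $\delta_{\psi(A)}=\delta_{\Pi}$.
   Context: Let $\mathbb{I}=[0,1]$ and let $d\ge 1$ be an integer. $\mathcal{C}^{k}$ is the family of all $k$-dimensional copulas. For $A\in\mathcal{C}^{d+1}$, $\mu_A$ denotes the probability measure on $\mathbb{I}^{d+1}$ with $\mu_A([\mathbf{0},\mathbf{u}]\times[0,v])=A(\mathbf{u},v)$; $A^{1:d}$ is the marginal of $A$ with respect to the first $d$ coordinates (for $d=1$, $\mu_{A^{1:d}}$ is Lebesgue measure $\lambda$ on $\mathbb{I}$); $K_A:\mathbb{I}^d\times\mathcal{B}(\mathbb{I})\to\mathbb{I}$ is (a version of) the Markov kernel of $A$, i.e. the regular conditional distribution of the last coordinate given the first $d$ coordinates, so that $A(\mathbf{u},v)=\int_{[\mathbf{0},\mathbf{u}]}K_A(\mathbf{p},[0,v])\,\mathrm{d}\mu_{A^{1:d}}(\mathbf{p})$. The map $\psi:\mathcal{C}^{d+1}\to\mathcal{C}^2$ is defined by $$\psi(A)(s,t)=\int_{\mathbb{I}^d}K_A(\mathbf{u},[0,s])\,K_A(\mathbf{u},[0,t])\,\mathrm{d}\mu_{A^{1:d}}(\mathbf{u}),\qquad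 (s,t)\in\mathbb{I}^2.$$ $M(s,t)=\min\{s,t\}$ is the comonotonicity copula and $\Pi(s,t)=st$ the independence copula. For $C\in\mathcal{C}^2$, $\delta_C(t)=C(t,t)$, $t\in\mathbb{I}$. $Y$ is completely dependent on $\mathbf{X}$ if there is a measurable function $f$ with $P(Y=f(\mathbf{X}))=1$. The connecting copula of $(\mathbf{X},Y)$ is the (unique) distribution function of $(F_1(X_1),\dots,F_d(X_d),G(Y))$, where $F_i$ and $G$ are the distribution functions of $X_i$ and $Y$. *)

(* Defs.v *)
From HB Require Import structures.
From mathcomp Require Import all_boot all_order all_algebra.
From mathcomp Require Import all_classical all_reals all_analysis.

Set Implicit Arguments.
Unset Strict Implicit.
Unset Printing Implicit Defensive.

Import Order.TTheory GRing.Theory Num.Theory.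
Import numFieldNormedType.Exports.

Local Open Scope classical_set_scope.
Local Open Scope ring_scope.

(* Points of R^n are n-tuples, with the product sigma-algebra of the library.
   Functions and measures that live on I^n are given on R^n, and all the
   conditions on them concern I^n only. *)
Section copula.
Context {R : realType}.

Definition cube n : set (n.-tuple R) :=
  [set u | forall i, tnth u i \in `[0, 1]].

(* [0, u] *)
Definition box0 n (u : n.-tuple R) : set (n.-tuple R) :=
  [set p | forall i, tnth p i \in `[0, tnth u i]].

(* The sum over S is the C-volume of the box [a, b], whose vertices are
   indexed by the set S of the coordinates at which they agree with a. *)
Definition copula n (C : n.-tuple R -> R) : Prop :=
  [/\ forall u, cube u -> (exists i, tnth u i = 0) -> C u = 0,
      forall u i, cube u -> (forall j, j != i -> tnth u j = 1) ->
        C u = tnth u i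
    & forall a b, cube a -> cube b -> (forall i, tnth a i <= tnth b i) ->
        0 <= \sum_(S : {set 'I_n}) (-1) ^+ #|S| *
               C [tuple if i \in S then tnth a i else tnth b i | i < n]].

Definition copula_measure n (C : n.-tuple R -> R)
    (mu : probability (n.-tuple R) R) : Prop :=
  forall u, cube u -> mu (box0 u) = (C u)%:E.

(* A(u, v) is A (rcons u v): the last coordinate is the distinguished one. *)
Definition first_marginal d (A : d.+1.-tuple R -> R) (u : d.-tuple R) : R :=
  A [tuple of rcons u 1].

(* K is a version of the Markov kernel of A, where mu is the measure of the
   marginal of A with respect to the first d coordinates. *)
Definition markov_kernel_of d (A : d.+1.-tuple R -> R)
    (mu : probability (d.-tuple R) R) (K : R.-pker (d.-tuple R) ~> R) : Prop :=
  (forall p, cube p -> K p [set` `[0, 1]] = 1%E) /\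
  (forall u v, cube u -> v \in `[0, 1] ->
    (A [tuple of rcons u v])%:E =
    (\int[mu]_(p in box0 u) K p [set` `[0%R, v]])%E).

Definition psi d (mu : probability (d.-tuple R) R)
    (K : R.-pker (d.-tuple R) ~> R) (s t : R) : R :=
  fine (\int[mu]_(u in @cube d)
    (K u [set` `[0%R, s]] * K u [set` `[0%R, t]]))%E.

Definition comonotonicity_copula (s t : R) : R := Num.min s t.

Definition independence_copula (s t : R) : R := s * t.

Definition diagonal_section (C : R -> R -> R) (t : R) : R := C t t.

End copula.

Section random_vector.
Context {disp : measure_display} {T : measurableType disp} {R : realType}
  {P : probability T R}.

Definition random_vector d (X : 'I_d -> {RV P >-> R}) (w : T) : d.-tuple R :=
  [tuple X i w | i < d].

Definition completely_dependent d (X : 'I_d -> {RV P >-> R})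
    (Y : {RV P >-> R}) : Prop :=
  exists2 f : d.-tuple R -> R, measurable_fun setT f &
    P [set w | Y w = f (random_vector X w)] = 1%E.

Definition independent d (X : 'I_d -> {RV P >-> R})
    (Y : {RV P >-> R}) : Prop :=
  forall (B : set (d.-tuple R)) (C : set R), measurable B -> measurable C ->
    P (random_vector X @^-1` B `&` Y @^-1` C) =
    (P (random_vector X @^-1` B) * P (Y @^-1` C))%E.

(* A is, on I^(d+1), the distribution function of
   (F_1(X_1), ..., F_d(X_d), G(Y)). *)
Definition connecting_copula d (X : 'I_d -> {RV P >-> R}) (Y : {RV P >-> R})
    (A : d.+1.-tuple R -> R) : Prop :=
  forall (u : d.-tuple R) (v : R), cube u -> v \in `[0, 1] ->
    (A [tuple of rcons u v])%:E =
    P [set w | (forall i, (cdf (X i) (X i w) <= (tnth u i)%:E)%E) /\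
               (cdf Y (Y w) <= v%:E)%E].

End random_vector.

(* Main.v *)
Require Import Defs.
From HB Require Import structures.
From mathcomp Require Import all_boot all_order all_algebra.
From mathcomp Require Import all_classical all_reals all_analysis.
From mathcomp Require Import measurable_realfun.

Set Implicit Arguments.
Unset Strict Implicit.
Unset Printing Implicit Defensive.

Import Order.TTheory GRing.Theory Num.Theory.
Import numFieldNormedType.Exports.

Local Open Scope classical_set_scope.
Local Open Scope ring_scope.

(** Write U = (F_1(X_1), ..., F_d(X_d)) and V = G(Y) for the distribution
    functions F_i and G of X_i and Y, and E_t for the event V <= t.  The first
    fact is that k_t(u) = K(u, [0, t]) is a version of the conditional
    probability of E_t given U, and that mu is the law of U: both say that two
    finite measures agree, and finite measures on the cube are determined by
    their values on the boxes [0, u], where the copula prescribes them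
    (eq_measure_box0, copula_measure_law, kernel_conditional_probability).
    Hence psi(A)(s, t) is the integral of k_s k_t with respect to the law of U,
    that is the mean of P(E_s | U) P(E_t | U) (psiE).

    The theorem then reduces to two extreme cases of P(E | U).
    - If E is, up to a null set, an event {U in B}, then P(E | U) is the
      indicator of B, so the integral of k_s k_t is P(E_s and E_t) = min(s, t).
      Conversely 0 <= k_t <= 1 gives k_t^2 <= k_t, so that an integral of k_t^2
      equal to t, the integral of k_t, forces k_t to be an indicator almost
      everywhere, and E_t to be an event {U in B} up to a null set
      (almost_preimage_of_integral).  Knowing this for every t is the same as
      knowing that Y is almost surely a measurable function of U, because a
      function is recovered from its sublevel sets at rational levels
      (almost_measurable_function).
    - If E is independent of U, then P(E | U) is the constant P(E), so the
      integral of k_s k_t is s t.  Conversely, if the integral of k_t^2 is t^2,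
      the square of the mean of k_t, then k_t has variance zero and is
      constant (independent_of_integral).  Only values psi(A)(t, t) enter
      here, which is why the diagonal section alone detects independence.

    It remains to pass between (X, Y) and (U, V).  The vector U is a function
    of X, and in the other direction the events {X_i <= a} and
    {F_i(X_i) <= F_i(a)} are nested with the same probability F_i(a), since
    F_i(X_i) is uniform by the margins of the copula; so they differ by a null
    set (prob_transform_ae_event).  These events generate all events about X,
    and each event about X is thus an event about U up to a null set. *)

(** * Events up to null sets *)

Notation "E '<->[ae' P ] F" := (\forall w \ae P, E w <-> F w)
  (at level 95, P at level 99, no associativity) : classical_set_scope.

Section almost_equal_events.
Context d (T : measurableType d) (R : realType) (P : probability T R).
Implicit Types E F G : set T.

Lemma ae_iff_sym E F : E <->[ae P] F -> F <->[ae P] E.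
Proof. by apply: filterS => w EF; apply: iff_sym. Qed.

Lemma ae_iff_trans F E G : E <->[ae P] F -> F <->[ae P] G -> E <->[ae P] G.
Proof. by apply: filterS2 => w; exact: iff_trans. Qed.

Lemma ae_iff_setI E E' F F' : E <->[ae P] E' -> F <->[ae P] F' ->
  (E `&` F) <->[ae P] (E' `&` F').
Proof. by apply: filterS2 => w EE FF; rewrite /setI/=; tauto. Qed.

Lemma ae_iff_probability E F : measurable E -> measurable F ->
  E <->[ae P] F -> P E = P F.
Proof.
move=> mE mF EF.
have diff0 A B : measurable A -> measurable B -> A <->[ae P] B ->
    P (A `\` B) = 0%E.
  move=> mA mB AB; apply: measure_negligible; first exact: measurableD.
  by apply: negligibleS AB => w [Aw nBw] AwB; apply: nBw; apply/AwB.
rewrite (measureDI P mE mF) [RHS](measureDI P mF mE).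
rewrite [X in (X + _)%E = _](diff0 E F)// [X in _ = (X + _)%E](diff0 F E)//.
  by rewrite setIC.
exact: ae_iff_sym.
Qed.

(** This is how events about X and Y are exchanged with events about their
    probability transforms: one inclusion and one equality of probabilities
    are enough. *)
Lemma ae_iff_nested E F : measurable E -> measurable F ->
  E `<=` F -> P E = P F -> E <->[ae P] F.
Proof.
move=> mE mF EF PEF; exists (F `\` E); split; first exact: measurableD.
- rewrite measureD//; last by rewrite ltey_eq fin_num_measure.
  by rewrite setIidr// [X in (_ - X)%E]PEF subee// fin_num_measure.
- move=> w /= EwF; have [Ew|nEw] := pselect (E w).
    by exfalso; apply: EwF; split => // _; exact: EF.
  have [Fw|nFw] := pselect (F w); first by split.
  by exfalso; apply: EwF; split.
Qed.

End almost_equal_events.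

(** The events of the completion of the sigma-algebra generated by Z. *)
Definition almost_preimage d (T : measurableType d) (R : realType)
    (P : probability T R) d' (S : measurableType d') (Z : T -> S) (E : set T) :=
  exists2 B, measurable B & E <->[ae P] Z @^-1` B.

Section almost_preimage.
Context d (T : measurableType d) (R : realType) (P : probability T R).
Context d' (S : measurableType d').
Implicit Types (Z : T -> S) (E F : set T).

Lemma almost_preimage_ae_iff Z E F : E <->[ae P] F ->
  almost_preimage P Z F -> almost_preimage P Z E.
Proof. by move=> EF [B mB FB]; exists B => //; exact: ae_iff_trans FB. Qed.

(** Countably many null sets have a null union, so being an event of Z up to a
    null set only has to be checked on generators. *)
Lemma almost_preimage_sigma_algebra (X : Type) (g : T -> X) Z :
  sigma_algebra setT [set C | almost_preimage P Z (g @^-1` C)].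
Proof.
split.
- by exists set0; [exact: measurable0|exact: aeW].
- move=> C [B mB CB]; exists (~` B); first exact: measurableC.
  by rewrite setTD; apply: filterS CB => w CB; rewrite /preimage /setC/=; tauto.
- move=> C preC; have [B mB CB] := all_sig2 (fun n => cid2 (preC n)).
  exists (\bigcup_i B i).
    exact: bigcup_measurable.
  apply: filterS (ae_foralln CB) => w /= CBw.
  by split=> -[i _ Ci]; exists i => //; apply/CBw.
Qed.

(** A null-set version of the Doob-Dynkin lemma: Y is the infimum of the
    rational levels q with Y <= q, and each of these countably many events may
    be replaced by an event on Z. *)
Lemma almost_measurable_function (Y : T -> R) Z :
  (forall a, almost_preimage P Z [set w | Y w <= a]) ->
  exists2 f : S -> R, measurable_fun setT f &
    \forall w \ae P, Y w = f (Z w).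
Proof.
move=> YZ.
(* every rational is some q n; an n that codes no rational repeats level 0 *)
pose q n : R := ratr (odflt 0 (unpickle n)).
have [B mB YB] := all_sig2 (fun n => cid2 (YZ (q n))).
pose h n x : \bar R := if x \in B n then (q n)%:E else +oo%E.
exists (fun x => fine (einfs (h ^~ x) 0%N)).
  apply: measurableT_comp => //.
  apply: measurable_fun_einfs => n.
  apply: measurable_fun_ifT; [|exact: measurable_cst..].
  apply: (measurable_fun_bool true); rewrite setTI.
  by rewrite [X in measurable X](preimage_mem_true (B n)).
apply: filterS (ae_foralln YB) => w /= YBw.
suff -> : einfs (h ^~ (Z w)) 0%N = (Y w)%:E by [].
have BE n : (Z w \in B n) = (Y w <= q n).
  by apply/idP/idP; rewrite inE => ?; apply/YBw.
apply/eqP; rewrite eq_le; apply/andP; split.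
- apply/lee_addgt0Pr => e e0.
  have [r] : exists r : rat, ratr r \in `]Y w, Y w + e[.
    by apply/rat_in_itvoo; rewrite ltrDl.
  rewrite in_itv/= => /andP[Yr rY].
  apply: (@le_trans _ _ (ratr r)%:E); last by rewrite lee_fin ltW.
  apply: ereal_inf_lbound; exists (pickle r) => //=.
  by rewrite /h BE /q pickleK/= ltW.
- apply: le_ereal_inf_tmp => _ [n _ <-].
  by rewrite /h BE; case: ifPn => Yq; rewrite ?leey// lee_fin.
Qed.

End almost_preimage.

(** * Generating classes and uniqueness of measures *)

Lemma measurable_le d (T : measurableType d) (R : realType) (f : T -> R) a :
  measurable_fun setT f -> measurable [set w | f w <= a].
Proof.
move=> mf; rewrite -[X in measurable X]setTI.
rewrite (_ : [set w | _] = f @^-1` `]-oo, a]); first exact: mf.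
by apply/seteqP; split=> w /=; rewrite in_itv.
Qed.

Section generators.
Context {R : realType}.

Lemma measurable_closed_rays (A : set R) : measurable A ->
  <<s [set `]-oo, a]%classic | a in [set: R]] >> A.
Proof.
rewrite -[measurable A]/(measurable (A : set (g_sigma_algebraType (@ocitv R)))).
rewrite RGenOInfty.measurableE.
apply: smallest_sub; first exact: smallest_sigma_algebra.
move=> _ [a ->]; rewrite -setCitvl; apply: sigma_algebraC.
by apply: sub_sigma_algebra; exists a.
Qed.

Definition half_space n (i : 'I_n) (a : R) : set (n.-tuple R) :=
  [set p | tnth p i <= a].

Lemma measurable_half_spaces n (A : set (n.-tuple R)) : measurable A ->
  <<s [set B | exists i a, B = half_space i a] >> A.
Proof.
apply: smallest_sub; first exact: smallest_sigma_algebra.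
move=> B; rewrite -bigcup_seq/= => -[i _ [C mC <-]].
have := measurable_closed_rays mC.
(* the sets whose cylinder is generated form a sigma-algebra *)
suff : <<s [set `]-oo, a]%classic | a in [set: R]] >> `<=`
  [set C | <<s [set B | exists i a, B = half_space i a] >>
              (setT `&` (@tnth n R ^~ i) @^-1` C)] by exact.
apply: smallest_sub.
  split => /=.
  - by rewrite preimage_set0 setI0; exact: sigma_algebra0.
  - by move=> D; rewrite !setTI setTD preimage_setC; exact: sigma_algebraC.
  - move=> F sF; rewrite preimage_bigcup setI_bigcupr.
    exact: sigma_algebra_bigcup.
move=> _ [a _ <-] /=; apply: sub_sigma_algebra; exists i, a.
by rewrite setTI; apply/seteqP; split=> p /=; rewrite in_itv.
Qed.

End generators.

Section measures_on_cube.
Context {R : realType}.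

Lemma eq_measure_closed_rays (m1 m2 : {measure set R -> \bar R}) :
  (forall a, m1 `]-oo, a]%classic = m2 `]-oo, a]%classic) ->
  (forall a, m1 `]-oo, a]%classic < +oo)%E ->
  forall A, measurable A -> m1 A = m2 A.
Proof.
move=> m12 m1oo A mA.
apply: (g_sigma_algebra_measure_unique
  [set `]-oo, a]%classic | a in [set: R]] _ (fun k => `]-oo, k%:R]%classic));
  last exact: measurable_closed_rays.
- by move=> _ [a _ <-].
- by move=> i; exists i%:R.
- apply/seteqP; split => // x _; exists (Num.bound `|x|) => //=.
  by rewrite in_itv/= (le_trans (ler_norm x))// ltW// archi_boundP.
- move=> _ _ [a _ <-] [b _ <-]; exists (Num.min a b) => //.
  by apply/seteqP; split=> x /=; rewrite !in_itv/= le_min => /andP.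
- by move=> _ [a _ <-]; exact: m12.
- by move=> k; exact: m1oo.
Qed.

Lemma measurable_forall_ord d (S : measurableType d) n (B : 'I_n -> set S) :
  (forall i, measurable (B i)) -> measurable [set p | forall i, B i p].
Proof.
move=> mB; rewrite (_ : [set p | _] = \bigcap_(i in [set: 'I_n]) B i).
  exact: fin_bigcap_measurable.
by apply/seteqP; split=> p Bp; [move=> i _|move=> i]; exact: Bp.
Qed.

Lemma measurable_tnth_set n (i : 'I_n) (C : set R) : measurable C ->
  measurable [set p : n.-tuple R | C (tnth p i)].
Proof.
by move=> mC; rewrite -[X in measurable X]setTI; exact: measurable_tnth.
Qed.

Lemma measurable_box0 n (u : n.-tuple R) : measurable (box0 u).
Proof.
apply: measurable_forall_ord => i.
exact: (@measurable_tnth_set _ _ [set` _]).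
Qed.

Lemma measurable_cube n : measurable (@cube R n).
Proof.
apply: measurable_forall_ord => i.
exact: (@measurable_tnth_set _ _ [set` _]).
Qed.

Definition lower_orthant n (u : n.-tuple R) : set (n.-tuple R) :=
  [set p | forall i, tnth p i <= tnth u i].

Lemma measurable_lower_orthant n (u : n.-tuple R) :
  measurable (lower_orthant u).
Proof.
apply: measurable_forall_ord => i.
by apply: measurable_le; exact: measurable_tnth.
Qed.

(** Orthants, unlike half spaces, are closed under intersection; a half space
    is a countable increasing union of them. *)
Lemma measurable_lower_orthants n (A : set (n.-tuple R)) : measurable A ->
  <<s [set lower_orthant u | u in [set: n.-tuple R]] >> A.
Proof.
move=> /measurable_half_spaces; apply: smallest_sub.
  exact: smallest_sigma_algebra.
move=> _ [i [a ->]].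
rewrite (_ : half_space i a = \bigcup_(k : nat)
    lower_orthant [tuple if j == i then a else k%:R | j < n]).
  apply: sigma_algebra_bigcup => k; apply: sub_sigma_algebra.
  by eexists.
apply/seteqP; split=> p.
- move=> pa.
  exists (\max_j Num.bound `|tnth p j|)%N => // j; rewrite tnth_mktuple.
  case: eqP => [->//|_]; rewrite (le_trans (ler_norm _))// ltW//.
  rewrite (lt_le_trans (archi_boundP _))// ler_nat.
  exact: (leq_bigmax (F := fun j => Num.bound `|tnth p j|)).
- by move=> [k _ /(_ i)]; rewrite tnth_mktuple eqxx.
Qed.

Lemma eq_measure_lower_orthants n
    (m1 m2 : {measure set (n.-tuple R) -> \bar R}) :
  (forall u, m1 (lower_orthant u) = m2 (lower_orthant u)) ->
  (forall u, m1 (lower_orthant u) < +oo)%E ->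
  forall A, measurable A -> m1 A = m2 A.
Proof.
move=> m12 m1oo A mA.
apply: (g_sigma_algebra_measure_unique
  [set lower_orthant u | u in [set: n.-tuple R]] _
  (fun k => lower_orthant [tuple k%:R | _ < n]));
  last exact: measurable_lower_orthants.
- by move=> _ [u _ <-]; exact: measurable_lower_orthant.
- by move=> k; eexists.
- apply/seteqP; split => // p _.
  exists (\max_j Num.bound `|tnth p j|)%N => // j; rewrite tnth_mktuple.
  rewrite (le_trans (ler_norm _))// ltW//.
  rewrite (lt_le_trans (archi_boundP _))// ler_nat.
  exact: (leq_bigmax (F := fun j => Num.bound `|tnth p j|)).
- move=> _ _ [u _ <-] [v _ <-].
  exists [tuple Num.min (tnth u i) (tnth v i) | i < n] => //.
  apply/seteqP; split=> p /=.
  + move=> puv; split=> i; have := puv i;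
    by rewrite tnth_mktuple le_min => /andP[].
  + by move=> [pu pv] i; rewrite tnth_mktuple le_min pu pv.
- by move=> _ [u _ <-]; exact: m12.
- by move=> k; exact: m1oo.
Qed.

(** On the cube a lower orthant is empty or a box [0, v], so measures carried
    by the cube are determined by the boxes alone. *)
Lemma eq_measure_box0 n (m1 m2 : {measure set (n.-tuple R) -> \bar R}) :
  m1 (~` @cube R n) = 0%E -> m2 (~` @cube R n) = 0%E ->
  (forall u, @cube R n u -> m1 (box0 u) = m2 (box0 u)) ->
  (forall u, @cube R n u -> m1 (box0 u) < +oo)%E ->
  forall A, measurable A -> m1 A = m2 A.
Proof.
move=> m1C m2C m12 m1oo.
have mO := @measurable_lower_orthant n.
have mcube u (m : {measure set (n.-tuple R) -> \bar R}) :
    m (~` @cube R n) = 0%E ->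
    m (lower_orthant u) = m (lower_orthant u `&` @cube R n).
  move=> mC; rewrite (measureDI _ (mO u) (@measurable_cube n)).
  rewrite [X in (X + _)%E](_ : _ = 0%E) ?add0e//.
  apply: (subset_measure0 _ _ _ mC) => //.
  - by apply: measurableD; [exact: mO|exact: measurable_cube].
  - by apply: measurableC; exact: measurable_cube.
have orthantE u : lower_orthant u `&` @cube R n = set0 \/
    exists2 v, @cube R n v & lower_orthant u `&` @cube R n = box0 v.
  have [u0|/forallNP u0] := pselect (exists i, tnth u i < 0).
    left; apply/seteqP; split => [p [pu pc]|p []]; case: u0 => i ui.
    have := pc i; rewrite in_itv/= => /andP[p0 _].
    by have := le_lt_trans (le_trans p0 (pu i)) ui; rewrite ltxx.
  right; exists [tuple Num.min (tnth u i) 1 | i < n].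
    move=> i; rewrite tnth_mktuple in_itv/=.
    rewrite le_min ler01 ge_min lexx orbT !andbT.
    by rewrite leNgt; apply/negP/u0.
  apply/seteqP; split => p.
    move=> [pu pc] i; have := pc i; rewrite tnth_mktuple !in_itv/= le_min.
    by move=> /andP[-> ->]; rewrite pu.
  move=> pb; split=> i; have := pb i; rewrite tnth_mktuple !in_itv/= le_min.
    by move=> /and3P[].
  by move=> /and3P[-> _ ->].
apply: eq_measure_lower_orthants => u.
  rewrite (mcube u m1 m1C) (mcube u m2 m2C).
  by have [->|[v cv ->]] := orthantE u; rewrite ?measure0//; exact: m12.
rewrite (mcube u m1 m1C).
by have [->|[v cv ->]] := orthantE u; rewrite ?measure0//; exact: m1oo.
Qed.

End measures_on_cube.

Section density.
Context d (S : measurableType d) (R : realType).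
Variables (mu : {measure set S -> \bar R}) (f : S -> \bar R).
Hypotheses (mf : measurable_fun setT f) (f0 : forall p, (0 <= f p)%E).

(** The two proofs are arguments so that the measure structure below can be
    found from the term. *)
Definition with_density of measurable_fun setT f & (forall p, (0 <= f p)%E) :=
  fun A : set S => (\int[mu]_(p in A) f p)%E.

Local Notation nu := (with_density mf f0).

Let nu0 : nu set0 = 0%E. Proof. exact: integral_set0. Qed.

Let nu_ge0 A : (0 <= nu A)%E.
Proof. by apply: integral_ge0 => p _; exact: f0. Qed.

Let nu_sigma_additive : semi_sigma_additive nu.
Proof.
move=> F mF tF mUF; rewrite /nu ge0_integral_bigcup//=.
- by apply: is_cvg_ereal_nneg_natsum => k _; exact: nu_ge0.
- exact: measurable_funTS.
Qed.

HB.instance Definition _ := isMeasure.Build _ _ _ nu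
  nu0 nu_ge0 nu_sigma_additive.

End density.

(** * Conditional probabilities and integrals of their products *)

Lemma le_integral_eq_ae d (S : measurableType d) (R : realType)
    (mu : {measure set S -> \bar R}) (f g : S -> R) :
  measurable_fun setT f -> measurable_fun setT g -> (forall p, 0 <= f p) ->
  (forall p, f p <= g p) -> (\int[mu]_p (f p)%:E < +oo)%E ->
  (\int[mu]_p (f p)%:E = \int[mu]_p (g p)%:E)%E ->
  \forall p \ae mu, f p = g p.
Proof.
move=> mf mg f0 fg foo fg_int.
have mEf : measurable_fun setT (EFin \o f) by exact/measurable_EFinP.
have mgf : measurable_fun setT (fun p => (g p - f p)%:E).
  by apply/measurable_EFinP; exact: measurable_funB.
have gf0 p : (0 <= (g p - f p)%:E)%E by rewrite lee_fin subr_ge0.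
have gf_int : (\int[mu]_p (g p - f p)%:E = 0)%E.
  have : (\int[mu]_p ((f p)%:E + (g p - f p)%:E) =
          \int[mu]_p (f p)%:E + \int[mu]_p (g p - f p)%:E)%E.
    by apply: ge0_integralD => // p _; rewrite lee_fin.
  under eq_integral do rewrite -EFinD addrC subrK.
  have If : (\int[mu]_p (f p)%:E)%E \is a fin_num.
    by rewrite ge0_fin_numE// integral_ge0// => p _; rewrite lee_fin.
  rewrite -fg_int addeC => /(congr1 (fun x => x - \int[mu]_p (f p)%:E)%E).
  by rewrite addeK// subee.
have : ae_eq mu setT (fun p => (g p - f p)%:E) (cst 0%E).
  apply/ae_eq_integral_abs => //.
  by rewrite -gf_int; apply: eq_integral => p _; rewrite gee0_abs.
by apply: filterS => p /(_ I)[] /eqP; rewrite subr_eq0 eq_sym => /eqP.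
Qed.

Section conditional_probability.
Context d (T : measurableType d) (R : realType) (P : probability T R).
Context d' (S : measurableType d') (mu : probability S R) (U : T -> S).
Hypothesis mU : measurable_fun setT U.
Hypothesis law_U : forall B, measurable B -> mu B = P (U @^-1` B).
Implicit Types (E F : set T) (B : set S) (k : S -> R).
Local Open Scope ereal_scope.

(** k is a version of the conditional probability of E given U, as a function
    of the value of U. *)
Definition conditional_probability E k :=
  [/\ measurable_fun setT k, forall p, (0 <= k p <= 1)%R
    & forall B, measurable B ->
        P (U @^-1` B `&` E) = \int[mu]_(p in B) (k p)%:E].

Let mpreU B : measurable B -> measurable (U @^-1` B).
Proof. by move=> mB; rewrite -[X in measurable X]setTI; exact: mU. Qed.

Let cp_integrable B E k : measurable B -> conditional_probability E k ->
  mu.-integrable B (EFin \o k).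
Proof.
move=> mB [mk k01 _]; apply: measurable_bounded_integrable => //.
- by rewrite ltey_eq fin_num_measure.
- exact: measurable_funTS.
- exists 1%R; split => // M M1 p _; have /andP[k0 k1] := k01 p.
  by rewrite /= ger0_norm// (le_trans k1)// ltW.
Qed.

Lemma conditional_probability_integral E k : conditional_probability E k ->
  \int[mu]_p (k p)%:E = P E.
Proof. by move=> [_ _ <-//]; rewrite preimage_setT setTI. Qed.

Lemma conditional_probability_unique E k (g : S -> R) :
  conditional_probability E k -> measurable_fun setT g ->
  (forall B, measurable B ->
     P (U @^-1` B `&` E) = \int[mu]_(p in B) (g p)%:E) ->
  \forall p \ae mu, k p = g p.
Proof.
move=> cp mg gE; have [mk k01 kE] := cp.
have : ae_eq mu setT (EFin \o k) (EFin \o g).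
  apply: integral_ae_eq => //.
  - exact: cp_integrable cp.
  - exact/measurable_EFinP.
  - by move=> B _ mB; rewrite -kE// gE.
by apply: filterS => p /(_ I)[].
Qed.

Lemma integral_mul_ae_eq k k' (g : S -> R) :
  measurable_fun setT k -> measurable_fun setT k' -> measurable_fun setT g ->
  (\forall p \ae mu, k p = g p) ->
  \int[mu]_p ((k p)%:E * (k' p)%:E) = \int[mu]_p ((g p)%:E * (k' p)%:E).
Proof.
move=> mk mk' mg kg; apply: ae_eq_integral => //.
- by apply: emeasurable_funM; exact/measurable_EFinP.
- by apply: emeasurable_funM; exact/measurable_EFinP.
- by apply: filterS kg => p -> _.
Qed.

(** Here k is the indicator of the event of U that E almost is, and the
    integral of k' over that event is the probability of its intersection
    with F. *)
Lemma integral_conditional_probability_preimage E k F k' :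
  measurable E -> measurable F ->
  conditional_probability E k -> conditional_probability F k' ->
  almost_preimage P U E ->
  \int[mu]_p ((k p)%:E * (k' p)%:E) = P (E `&` F).
Proof.
move=> mE mF cp cp' [D mD ED]; have [mk _ _] := cp; have [mk' _ k'E] := cp'.
have mI : measurable_fun setT (\1_D : S -> R) by exact: measurable_indic.
rewrite (integral_mul_ae_eq mk mk' mI).
  rewrite (eq_integral ((EFin \o k') \_ D)).
    rewrite -integral_mkcond -k'E//; apply: ae_iff_probability.
    - by apply: measurableI => //; exact: mpreU.
    - exact: measurableI.
    - by apply: ae_iff_setI; [exact: ae_iff_sym|exact: aeW].
  move=> p _; rewrite patchE indicE.
  by case: (p \in D); rewrite ?mul1e ?mul0e.
apply: conditional_probability_unique cp mI _ => B mB.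
rewrite integral_indic// [RHS]law_U; last exact: measurableI.
apply: ae_iff_probability.
- by apply: measurableI => //; exact: mpreU.
- by apply: mpreU; exact: measurableI.
- rewrite preimage_setI setIC.
  by apply: ae_iff_setI => //; exact: aeW.
Qed.

(** As k takes values in [0, 1], k^2 <= k, and the two functions have the same
    integral; so k is almost everywhere 0 or 1.  Then E and {k(U) = 1} both
    have the probability of their intersection. *)
Lemma almost_preimage_of_integral E k : measurable E ->
  conditional_probability E k ->
  \int[mu]_p ((k p)%:E * (k p)%:E) = P E -> almost_preimage P U E.
Proof.
move=> mE cp kkE; have [mk k01 kE] := cp.
have kk : \forall p \ae mu, (k p * k p)%R = k p.
  apply: le_integral_eq_ae => //.
  - exact: measurable_funM.
  - by move=> p; have /andP[k0 _] := k01 p; exact: mulr_ge0.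
  - by move=> p; have /andP[k0 k1] := k01 p; rewrite ler_piMr.
  - by under eq_integral do rewrite EFinM; rewrite kkE ltey_eq fin_num_measure.
  - under eq_integral do rewrite EFinM.
    by rewrite kkE (conditional_probability_integral cp).
pose D := k @^-1` [set 1%R].
have mD : measurable D by rewrite -[X in measurable X]setTI; exact: mk.
exists D => //.
have mUD := mpreU mD.
have kD : \forall p \ae mu, k p = \1_D p.
  apply: filterS kk => p kkp; rewrite indicE.
  have [kp|kp] := eqVneq (k p) 1%R; first by rewrite mem_set.
  rewrite memNset; last exact/eqP.
  apply/eqP; have : (k p * (k p - 1) == 0)%R by rewrite mulrBr mulr1 kkp subrr.
  by rewrite mulf_eq0 subr_eq0 (negbTE kp) orbF.
have intD B : measurable B -> P (U @^-1` B `&` E) = mu (D `&` B).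
  move=> mB; rewrite kE// -integral_indic//; apply: ae_eq_integral => //.
  - by apply: measurable_funTS; exact/measurable_EFinP.
  - by apply: measurable_funTS; apply/measurable_EFinP; exact: measurable_indic.
  - by apply: filterS kD => p -> _.
apply: (@ae_iff_trans _ _ _ _ (U @^-1` D `&` E)).
  apply: ae_iff_sym; apply: ae_iff_nested => //; first exact: measurableI.
  rewrite intD// setIid -[in RHS](setTI E) -(preimage_setT U) intD//.
  by rewrite setIT.
apply: ae_iff_nested => //; first exact: measurableI.
by rewrite intD// setIid [LHS]law_U.
Qed.

(** Here k is the constant P(E). *)
Lemma integral_conditional_probability_independent E k F k' :
  measurable E -> measurable F ->
  conditional_probability E k -> conditional_probability F k' ->
  (forall B, measurable B -> P (U @^-1` B `&` E) = P (U @^-1` B) * P E) ->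
  \int[mu]_p ((k p)%:E * (k' p)%:E) = P E * P F.
Proof.
move=> mE mF cp cp' UE; have [mk _ _] := cp; have [mk' k'01 _] := cp'.
have mc : measurable_fun setT (cst (fine (P E)) : S -> R) by [].
have PE : (fine (P E))%:E = P E by rewrite fineK// fin_num_measure.
rewrite (integral_mul_ae_eq mk mk' mc).
  rewrite /= ge0_integralZl//=.
  - by rewrite PE (conditional_probability_integral cp').
  - exact/measurable_EFinP.
  - by move=> p _; have /andP[] := k'01 p.
  - by rewrite PE.
apply: conditional_probability_unique cp mc _ => B mB.
rewrite [RHS](integral_cst mu mB (fine (P E))%:E) UE// PE muleC.
by congr (_ * _); rewrite [RHS]law_U.
Qed.

(** The case of equality in the Cauchy-Schwarz inequality: the hypothesis is
    that k(U) has variance zero. *)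
Lemma independent_of_integral E k : measurable E ->
  conditional_probability E k ->
  \int[mu]_p ((k p)%:E * (k p)%:E) = P E * P E ->
  forall B, measurable B -> P (U @^-1` B `&` E) = P (U @^-1` B) * P E.
Proof.
move=> mE cp kkE B mB; have [mk k01 kE] := cp.
pose c := fine (P E).
have PE : P E = c%:E by rewrite fineK// fin_num_measure.
have c0 : (0 <= c)%R by exact: fine_ge0.
(* 2 c k <= k^2 + c^2, and both sides have the integral 2 c^2 *)
have kc : \forall p \ae mu, (c *+ 2 * k p)%R = (k p * k p + c * c)%R.
  have int_l : \int[mu]_p (c *+ 2 * k p)%:E = ((c * c) *+ 2)%:E.
    under eq_integral do rewrite EFinM.
    rewrite ge0_integralZl//=.
    + rewrite (conditional_probability_integral cp) PE -EFinM.
      by rewrite mulrnAl.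
    + exact/measurable_EFinP.
    + by move=> p _; have /andP[] := k01 p.
    + by rewrite lee_fin mulrn_wge0.
  apply: le_integral_eq_ae => //.
  - exact: measurable_funM.
  - by apply: measurable_funD => //; exact: measurable_funM.
  - by move=> p; have /andP[k0 _] := k01 p; rewrite mulr_ge0// mulrn_wge0.
  - move=> p; rewrite -subr_ge0.
    rewrite (_ : _ - _ = (k p - c) ^+ 2)%R ?sqr_ge0//.
    by rewrite sqrrB !expr2 mulrnAl (mulrC c (k p)) addrAC.
  - by rewrite int_l ltry.
  - rewrite int_l; under [RHS]eq_integral do rewrite EFinD.
    rewrite ge0_integralD//.
    + under eq_integral do rewrite EFinM.
      rewrite kkE PE (integral_cst mu measurableT (c * c)%:E).
      by rewrite [X in _ + _ * X]probability_setT mule1 -EFinM -EFinD mulr2n.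
    + by move=> p _; have /andP[k0 _] := k01 p; rewrite lee_fin mulr_ge0.
    + by apply/measurable_EFinP; exact: measurable_funM.
    + by move=> p _; rewrite lee_fin mulr_ge0.
rewrite kE//.
rewrite (@ae_eq_integral _ _ _ _ _ (cst c%:E))//.
- rewrite [LHS](integral_cst mu mB c%:E) PE muleC.
  by congr (_ * _); rewrite [LHS]law_U.
- by apply: measurable_funTS; exact/measurable_EFinP.
- apply: filterS kc => p kcp _; congr EFin; apply/eqP.
  rewrite -subr_eq0 -sqrf_eq0 sqrrB !expr2 addrAC -kcp.
  by rewrite mulrnAl (mulrC c (k p)) subrr.
Qed.

End conditional_probability.

(** * Probability transforms and the Markov kernel of a copula *)

Section extend_tuple.
Context {R : realType} (d : nat).
Implicit Types (u : d.-tuple R) (v : R).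

Lemma tnth_rcons_last u v : tnth [tuple of rcons u v] ord_max = v.
Proof. by rewrite (tnth_nth 0)/= nth_rcons size_tuple ltnn eqxx. Qed.

Lemma tnth_rcons_init u v (i : 'I_d.+1) (j : 'I_d) : i = j :> nat ->
  tnth [tuple of rcons u v] i = tnth u j.
Proof.
by move=> ij; rewrite !(tnth_nth 0)/= nth_rcons size_tuple ij ltn_ord.
Qed.

Lemma ord_last_or_init (i : 'I_d.+1) :
  i = ord_max \/ exists j : 'I_d, i = j :> nat.
Proof.
have [id|di] := ltnP i d; first by right; exists (Ordinal id).
by left; apply/val_inj/eqP; rewrite eqn_leq di -ltnS ltn_ord.
Qed.

Lemma cube_rcons u v : cube u -> v \in `[0, 1] -> cube [tuple of rcons u v].
Proof.
move=> cu v01 i; have [->|[j ij]] := ord_last_or_init i.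
  by rewrite tnth_rcons_last.
by rewrite (tnth_rcons_init _ _ ij).
Qed.

End extend_tuple.

Section probability_transform.
Context {disp : measure_display} {T : measurableType disp} {R : realType}
  {P : probability T R}.

Definition prob_transform (Y : {RV P >-> R}) (w : T) : R := fine (cdf Y (Y w)).

Implicit Type Y : {RV P >-> R}.

Lemma cdf_fin_num Y a : cdf Y a \is a fin_num.
Proof. by rewrite fin_num_measure. Qed.

Lemma fine_cdf_itv Y a : fine (cdf Y a) \in `[0, 1].
Proof.
by rewrite in_itv/= -!lee_fin fineK ?cdf_fin_num// cdf_ge0 cdf_le1.
Qed.

Lemma prob_transform_itv Y w : prob_transform Y w \in `[0, 1].
Proof. exact: fine_cdf_itv. Qed.

Lemma measurable_prob_transform Y : measurable_fun setT (prob_transform Y).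
Proof.
apply: measurableT_comp => //; apply: measurableT_comp => //.
exact: cdf_measurable.
Qed.

Lemma prob_transform_le Y w v :
  (cdf Y (Y w) <= v%:E)%E <-> prob_transform Y w <= v.
Proof. by rewrite -lee_fin fineK// cdf_fin_num. Qed.

Lemma almost_sure_eqP (f g : T -> R) : measurable_fun setT f ->
  measurable_fun setT g ->
  P [set w | f w = g w] = 1%E <-> \forall w \ae P, f w = g w.
Proof.
move=> mf mg; have mfg : measurable [set w | f w = g w].
  rewrite (_ : [set w | _] = (f \- g) @^-1` [set 0]).
    by rewrite -[X in measurable X]setTI; apply: measurable_funB.
  by apply/seteqP; split=> w /=; [move=> ->; rewrite subrr|move/subr0_eq].
have mfgC := measurableC mfg.
split=> fg.
  apply/negligibleP => //.
  by rewrite [LHS]probability_setC// [X in (_ - X)%E]fg subee.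
have : P (~` [set w | f w = g w]) = 0%E by apply: measure_negligible.
rewrite probability_setC// => /eqP; rewrite sube_eq//.
by rewrite add0e => /eqP ->.
Qed.

(** G may be constant on an interval to the right of a, where Y has mass zero:
    the second event contains the first and, G(Y) being uniform, both have
    probability G(a). *)
Lemma prob_transform_ae_event Y a :
  (forall t, t \in `[0, 1] -> P [set w | prob_transform Y w <= t] = t%:E) ->
  [set w | Y w <= a] <->[ae P]
  [set w | prob_transform Y w <= fine (cdf Y a)].
Proof.
move=> Yunif; apply: ae_iff_nested.
- exact: measurable_le.
- by apply: measurable_le; exact: measurable_prob_transform.
- move=> w /= Ywa; rewrite -lee_fin !fineK ?cdf_fin_num//.
  exact: cdf_nondecreasing.
- rewrite Yunif ?fine_cdf_itv// fineK ?cdf_fin_num//.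
Qed.

Definition prob_transforms d (X : 'I_d -> {RV P >-> R}) (w : T) : d.-tuple R :=
  [tuple prob_transform (X i) w | i < d].

Lemma measurable_prob_transforms d (X : 'I_d -> {RV P >-> R}) :
  measurable_fun setT (prob_transforms X).
Proof.
apply/measurable_fun_tnthP => i.
rewrite (_ : _ \o _ = prob_transform (X i)).
  exact: measurable_prob_transform.
by apply/funext => w /=; rewrite tnth_mktuple.
Qed.

Lemma measurable_random_vector d (X : 'I_d -> {RV P >-> R}) :
  measurable_fun setT (random_vector X).
Proof.
apply/measurable_fun_tnthP => i.
by rewrite (_ : _ \o _ = X i)//; apply/funext => w /=; rewrite tnth_mktuple.
Qed.

Lemma prob_transforms_cube d (X : 'I_d -> {RV P >-> R}) w :
  cube (prob_transforms X w).
Proof. by move=> i; rewrite tnth_mktuple; exact: prob_transform_itv. Qed.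

End probability_transform.

Definition kernel_cdf {R : realType} d (K : R.-pker (d.-tuple R) ~> R)
  (v : R) (p : d.-tuple R) : R := fine (K p [set` `[0%R, v]]).

Section copula_kernel.
Context {disp : measure_display} {T : measurableType disp} {R : realType}
  {P : probability T R} {d : nat}.
Variables (X : 'I_d -> {RV P >-> R}) (Y : {RV P >-> R}).
Variable A : d.+1.-tuple R -> R.
Hypotheses (hA : copula A) (hXYA : connecting_copula X Y A).

Local Notation U := (prob_transforms X).
Local Notation V := (prob_transform Y).

Lemma connecting_copulaE u v : cube u -> v \in `[0, 1] ->
  P (U @^-1` box0 u `&` [set w | V w <= v]) = (A [tuple of rcons u v])%:E.
Proof.
move=> cu v01; rewrite hXYA//; congr (P _); apply/seteqP; split=> w /=.
- move=> [Uu Vv]; split; last exact/prob_transform_le.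
  move=> i; apply/prob_transform_le.
  by have := Uu i; rewrite tnth_mktuple in_itv/= => /andP[].
- move=> [Uu /prob_transform_le Vv]; split => // i.
  rewrite tnth_mktuple in_itv/=.
  have := prob_transform_itv (X i) w; rewrite in_itv/= => /andP[-> _]/=.
  exact/prob_transform_le.
Qed.

(** The event G(Y) <= t is that of the box with all the other bounds 1, so its
    probability is a univariate margin of the copula. *)
Lemma prob_transform_last_uniform t : t \in `[0, 1] ->
  P [set w | V w <= t] = t%:E.
Proof.
move=> t01; pose u : d.-tuple R := [tuple 1 | _ < d].
have cu : cube u by move=> i; rewrite tnth_mktuple in_itv/= ler01 lexx.
transitivity (A [tuple of rcons u t])%:E.
  rewrite -connecting_copulaE//; congr (P _); apply/seteqP; split=> w /=.
    move=> Vt; split => // i; have := prob_transforms_cube X w i.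
    by rewrite [tnth u i]tnth_mktuple.
  by case.
have [_ marg _] := hA; congr EFin.
rewrite (marg _ ord_max); first exact: tnth_rcons_last.
  exact: cube_rcons.
move=> i; have [->|[j ij] _] := ord_last_or_init i; first by rewrite eqxx.
by rewrite (tnth_rcons_init _ _ ij) tnth_mktuple.
Qed.

Lemma prob_transform_coord_uniform i t : t \in `[0, 1] ->
  P [set w | prob_transform (X i) w <= t] = t%:E.
Proof.
move=> t01; pose u : d.-tuple R := [tuple if j == i then t else 1 | j < d].
have i01 : (1 : R) \in `[0, 1] by rewrite in_itv/= ler01 lexx.
have cu : cube u by move=> j; rewrite tnth_mktuple; case: ifP.
transitivity (A [tuple of rcons u 1])%:E.
  rewrite -connecting_copulaE//; congr (P _); apply/seteqP; split=> w /=.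
    move=> Ut; split; last first.
      by have := prob_transform_itv Y w; rewrite in_itv => /andP[].
    move=> j; have := prob_transforms_cube X w j; rewrite !tnth_mktuple.
    by case: eqP => [->|//]; rewrite !in_itv/= => /andP[-> _]/=.
  move=> [/(_ i) + _]; rewrite !tnth_mktuple eqxx in_itv/=.
  by move=> /andP[].
have [_ marg _] := hA; congr EFin.
pose i' : 'I_d.+1 := widen_ord (leqnSn d) i.
rewrite (marg _ i').
- by rewrite (@tnth_rcons_init _ _ _ _ i' i)// tnth_mktuple eqxx.
- exact: cube_rcons.
move=> k; have [->|[j kj] ki] := ord_last_or_init k.
  by rewrite tnth_rcons_last.
rewrite (tnth_rcons_init _ _ kj) tnth_mktuple ifN//.
by apply: contra ki => /eqP ji; apply/eqP/val_inj; rewrite /= kj ji.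
Qed.

Variable mu : probability (d.-tuple R) R.
Hypothesis hmu : copula_measure (first_marginal A) mu.

Let one01 : (1 : R) \in `[0, 1]. Proof. by rewrite in_itv/= ler01 lexx. Qed.

Let cube1 : @cube R d [tuple 1 | _ < d].
Proof. by move=> i; rewrite tnth_mktuple. Qed.

Let cubeE : @cube R d = box0 [tuple 1 | _ < d].
Proof.
by apply/seteqP; split=> p cp i; have := cp i; rewrite tnth_mktuple.
Qed.

Let preU_cube : U @^-1` (~` @cube R d) = set0.
Proof.
by apply/seteqP; split=> // w; have := prob_transforms_cube X w.
Qed.

Let V_le1 : [set w | V w <= 1] = setT.
Proof.
apply/seteqP; split=> // w _ /=.
by have := prob_transform_itv Y w; rewrite in_itv => /andP[].
Qed.

Let mu_box0 u : cube u -> mu (box0 u) = P (U @^-1` box0 u).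
Proof.
move=> cu; rewrite hmu// /first_marginal -connecting_copulaE//.
by rewrite V_le1 setIT.
Qed.

Lemma copula_measure_cubeC : mu (~` @cube R d) = 0%E.
Proof.
rewrite probability_setC; last exact: measurable_cube.
rewrite cubeE [X in (1 - X)%E]mu_box0// -cubeE.
rewrite (_ : U @^-1` _ = setT) ?[X in (1 - X)%E]probability_setT ?subee//.
by apply/seteqP; split=> // w _; exact: prob_transforms_cube.
Qed.

Let Um : {mfun T >-> d.-tuple R} :=
  mfun_Sub (mem_set (measurable_prob_transforms X)).

(** The law of U and mu both give the mass A(u, 1) to the box [0, u]. *)
Lemma copula_measure_law B : measurable B -> mu B = P (U @^-1` B).
Proof.
move=> mB.
apply: (@eq_measure_box0 _ _ mu (distribution P Um)) => //.
- exact: copula_measure_cubeC.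
- by rewrite [LHS](congr1 P preU_cube) measure0.
- by move=> u cu; rewrite ltey_eq fin_num_measure//; exact: measurable_box0.
Qed.

Variable K : R.-pker (d.-tuple R) ~> R.
Hypothesis hK : markov_kernel_of A mu K.

Local Notation k := (kernel_cdf K).

Let K01 v p : (0 <= K p [set` `[0%R, v]] <= 1)%E.
Proof.
rewrite measure_ge0/= -(@prob_kernel _ _ _ _ _ K p).
by apply: le_measure; rewrite ?inE.
Qed.

Let kE v p : (k v p)%:E = K p [set` `[0%R, v]].
Proof.
rewrite fineK//; have /andP[K0 K1] := K01 v p.
by rewrite ge0_fin_numE// (le_lt_trans K1)// ltry.
Qed.

Let mk v : measurable_fun setT (k v).
Proof. by apply: measurableT_comp => //; exact: measurable_kernel. Qed.

(** As functions of B, both sides of the defining identity are finite measures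
    that give the mass A(u, v) to the box [0, u]. *)
Lemma kernel_conditional_probability v : v \in `[0, 1] ->
  conditional_probability P mu U [set w | V w <= v] (k v).
Proof.
move=> v01; split => //.
  by move=> p; rewrite -!lee_fin kE.
move=> B mB.
have mE : measurable [set w | V w <= v].
  by apply: measurable_le; exact: measurable_prob_transform.
have k0 p : (0 <= (k v p)%:E)%E by rewrite kE.
have mEk : measurable_fun setT (EFin \o k v) by exact/measurable_EFinP.
apply: (@eq_measure_box0 _ _ (pushforward (mrestr P mE) Um)
  (with_density mu mEk k0)) => //.
- by rewrite [LHS](congr1 (fun D => P (D `&` _)) preU_cube) set0I measure0.
- apply: null_set_integral; last exact: copula_measure_cubeC.
  + by apply: measurableC; exact: measurable_cube.
  + exact: measurable_funTS.
- move=> u cu; rewrite [LHS](connecting_copulaE cu v01) hK.2//.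
  by apply: eq_integral => p _; rewrite /= kE.
- move=> u cu; rewrite (le_lt_trans (@probability_le1 _ _ _ P _ _)) ?ltry//.
  apply: measurableI => //.
  exact: (measurable_funPTI Um (measurable_box0 u)).
Qed.

(** The cube has full measure, so the restriction of the integral to it is
    immaterial; and fine loses nothing, the integrand being at most 1. *)
Lemma psiE s t :
  ((psi mu K s t)%:E = \int[mu]_p ((k s p)%:E * (k t p)%:E))%E.
Proof.
have mcube := @measurable_cube R d.
have mkk : measurable_fun setT (fun p => (k s p)%:E * (k t p)%:E)%E.
  by apply: emeasurable_funM; apply/measurable_EFinP; exact: mk.
have kk0 p : (0 <= (k s p)%:E * (k t p)%:E)%E by rewrite !kE mule_ge0.
have -> : psi mu K s t = fine (\int[mu]_p ((k s p)%:E * (k t p)%:E))%E.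
  congr fine.
  rewrite [RHS](@ge0_negligible_integral _ _ _ _ _ (~` @cube R d))//.
  - rewrite setDE setCK setTI.
    by apply: eq_integral => p _; rewrite !kE.
  - exact: measurableC.
  - exact: copula_measure_cubeC.
rewrite fineK// ge0_fin_numE; last exact: integral_ge0.
apply: (@le_lt_trans _ _ (\int[mu]_p (cst 1%:E) p)%E); last first.
  by rewrite integral_cst// mul1e ltey_eq fin_num_measure.
apply: ge0_le_integral => // p _; rewrite /= !kE -[leRHS]mule1.
have /andP[s0 s1] := K01 s p; have /andP[t0 t1] := K01 t p.
exact: lee_pmul.
Qed.

End copula_kernel.

(** * Complete dependence and independence in terms of psi *)

Lemma almost_preimage_random_vector (disp : measure_display)
    (T : measurableType disp) (R : realType) (P : probability T R) d
    (X : 'I_d -> {RV P >-> R}) d' (S : measurableType d') (Z : T -> S) :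
  (forall i a, almost_preimage P Z [set w | X i w <= a]) ->
  forall B, measurable B -> almost_preimage P Z (random_vector X @^-1` B).
Proof.
move=> XZ B /measurable_half_spaces.
apply: (smallest_sub (almost_preimage_sigma_algebra P _ _)).
move=> _ [i [a ->]] /=.
rewrite (_ : _ @^-1` _ = [set w | X i w <= a]); first exact: XZ.
by apply/seteqP; split=> w; rewrite /half_space /preimage /= tnth_mktuple.
Qed.

Section characterizations.
Context {disp : measure_display} {T : measurableType disp} {R : realType}
  {P : probability T R} {d : nat}.
Variables (X : 'I_d -> {RV P >-> R}) (Y : {RV P >-> R}).
Variables (A : d.+1.-tuple R -> R) (mu : probability (d.-tuple R) R)
  (K : R.-pker (d.-tuple R) ~> R).
Hypotheses (hA : copula A) (hXYA : connecting_copula X Y A).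
Hypotheses (hmu : copula_measure (first_marginal A) mu)
  (hK : markov_kernel_of A mu K).

Local Notation U := (prob_transforms X).
Local Notation E t := [set w | prob_transform Y w <= t].

Let mU : measurable_fun setT U. Proof. exact: measurable_prob_transforms. Qed.

Let lawU B : measurable B -> mu B = P (U @^-1` B).
Proof. exact: (copula_measure_law hXYA hmu). Qed.

Let mE t : measurable (E t).
Proof. by apply: measurable_le; exact: measurable_prob_transform. Qed.

Let PE t : t \in `[0, 1] -> P (E t) = t%:E.
Proof. exact: (prob_transform_last_uniform hA hXYA). Qed.

Let cpE t : t \in `[0, 1] ->
  conditional_probability P mu U (E t) (kernel_cdf K t).
Proof. exact: (kernel_conditional_probability hXYA hmu hK). Qed.

Let psi_int s t := psiE hXYA hmu K s t.

Let Y_le a : [set w | Y w <= a] <->[ae P] E (fine (cdf Y a)).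
Proof. by apply: prob_transform_ae_event; exact: PE. Qed.

Let X_preU B : measurable B -> almost_preimage P U (random_vector X @^-1` B).
Proof.
apply: almost_preimage_random_vector => i a.
exists [set p | tnth p i <= fine (cdf (X i) a)].
  by apply: measurable_le; exact: measurable_tnth.
apply: ae_iff_trans (prob_transform_ae_event _ _) _.
  exact: (prob_transform_coord_uniform hA hXYA).
by apply: aeW => w; rewrite /preimage/= tnth_mktuple.
Qed.

(* U is g(X) everywhere; only the passage from U to X costs a null set. *)
Let g (p : d.-tuple R) : d.-tuple R :=
  [tuple fine (cdf (X i) (tnth p i)) | i < d].

Let mg : measurable_fun setT g.
Proof.
apply/measurable_fun_tnthP => i.
rewrite (_ : _ \o _ = (fine \o cdf (X i)) \o (@tnth d R)^~ i); last first.
  by apply/funext => p /=; rewrite tnth_mktuple.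
apply: measurableT_comp; last exact: measurable_tnth.
by apply: measurableT_comp => //; exact: cdf_measurable.
Qed.

Let UgX B : U @^-1` B = random_vector X @^-1` (g @^-1` B).
Proof.
suff -> : U = g \o random_vector X by [].
by apply/funext => w; apply: eq_from_tnth => i /=; rewrite !tnth_mktuple.
Qed.

Let mgB B : measurable B -> measurable (g @^-1` B).
Proof. by move=> mB; rewrite -[X in measurable X]setTI; exact: mg. Qed.

Let level t : set R := [set y | fine (cdf Y y) <= t].

Let mlevel t : measurable (level t).
Proof.
by apply: measurable_le; apply: measurableT_comp => //; exact: cdf_measurable.
Qed.

Let E_min s t : E s `&` E t = E (Num.min s t).
Proof. by apply/seteqP; split=> w /=; rewrite le_min => /andP. Qed.

Lemma completely_dependent_psi : completely_dependent X Y ->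
  {in `[0, 1] &, psi mu K =2 comonotonicity_copula}.
Proof.
move=> [f mf /almost_sure_eqP YfX] s t s01 t01.
have {}YfX : \forall w \ae P, Y w = f (random_vector X w).
  apply: YfX => //; apply: measurableT_comp => //.
  exact: measurable_random_vector.
apply: EFin_inj; rewrite psi_int.
rewrite (integral_conditional_probability_preimage mU lawU (mE s) (mE t))//;
  first last.
- have mfl : measurable (f @^-1` level s).
    by rewrite -[X in measurable X]setTI; apply: mf.
  apply: almost_preimage_ae_iff (X_preU mfl).
  by apply: filterS YfX => w Yw; rewrite /preimage /level/= -Yw.
- exact: cpE.
- exact: cpE.
rewrite E_min PE// in_itv/=; move: s01 t01; rewrite !in_itv/=.
by move=> /andP[s0 s1] /andP[t0 t1]; rewrite le_min s0 t0 ge_min s1.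
Qed.

Lemma psi_completely_dependent :
  {in `[0, 1] &, psi mu K =2 comonotonicity_copula} ->
  completely_dependent X Y.
Proof.
move=> psiM.
have EU t : t \in `[0, 1] -> almost_preimage P U (E t).
  move=> t01; apply: (almost_preimage_of_integral mU lawU (mE t) (cpE t01)).
  by rewrite -psi_int psiM// /comonotonicity_copula minxx PE.
have [a|f mf YfX] :=
    @almost_measurable_function _ _ _ P _ _ Y (random_vector X).
  apply: almost_preimage_ae_iff (Y_le a) _.
  have [B mB EB] := EU _ (fine_cdf_itv Y a).
  by exists (g @^-1` B); [exact: mgB|rewrite -UgX].
exists f => //; apply/almost_sure_eqP => //.
by apply: measurableT_comp => //; exact: measurable_random_vector.
Qed.

Lemma independent_psi : independent X Y ->
  {in `[0, 1] &, psi mu K =2 independence_copula}.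
Proof.
move=> XY s t s01 t01; apply: EFin_inj; rewrite psi_int.
rewrite (integral_conditional_probability_independent lawU (mE s) (mE t))//.
- by rewrite !PE.
- exact: cpE.
- exact: cpE.
- by move=> B mB; rewrite UgX; exact: (XY _ _ (mgB mB) (mlevel s)).
Qed.

(** The product rule for U and E_t extends to X and Y: an event about X is one
    about U up to a null set, and for fixed B both sides of the product rule
    are finite measures in C, so the rays Y <= a suffice. *)
Lemma diagonal_psi_independent :
  {in `[0, 1], diagonal_section (psi mu K) =1
               diagonal_section independence_copula} -> independent X Y.
Proof.
move=> psiPi B C mB mC.
have UE t : t \in `[0, 1] -> forall D, measurable D ->
    P (U @^-1` D `&` E t) = (P (U @^-1` D) * P (E t))%E.
  move=> t01; apply: (independent_of_integral lawU (mE t) (cpE t01)).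
  rewrite -psi_int PE//; congr EFin; exact: psiPi.
have mXB : measurable (random_vector X @^-1` B).
  by rewrite -[X in measurable X]setTI; apply: measurable_random_vector.
have [D mD BD] := X_preU mB.
have mUD : measurable (U @^-1` D).
  by rewrite -[X in measurable X]setTI; apply: mU.
have PXB : P (random_vector X @^-1` B) = P (U @^-1` D).
  exact: ae_iff_probability.
have r0 : 0 <= fine (P (random_vector X @^-1` B)) by exact: fine_ge0.
pose r : {nonneg R} := NngNum r0.
have rE : (r%:num%:E = P (random_vector X @^-1` B))%E.
  by rewrite /= fineK// fin_num_measure.
rewrite -rE setIC.
apply: (@eq_measure_closed_rays _ (pushforward (mrestr P mXB) Y)
  (mscale r (distribution P Y))) => //.
- move=> a.
  have Ya : Y @^-1` `]-oo, a] = [set w | Y w <= a].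
    by apply/seteqP; split=> w /=; rewrite in_itv.
  change (P (Y @^-1` `]-oo, a]%classic `&` random_vector X @^-1` B) =
    (r%:num%:E * P (Y @^-1` `]-oo, a]%classic))%E).
  rewrite rE Ya setIC PXB.
  rewrite -[X in (_ * X)%E](ae_iff_probability _ _ (ae_iff_sym (Y_le a)))//;
    last first.
    exact: measurable_le.
  rewrite -UE//; last exact: fine_cdf_itv.
  apply: ae_iff_probability; last exact: ae_iff_setI.
  - by apply: measurableI => //; exact: measurable_le.
  - exact: measurableI.
- move=> a; apply: le_lt_trans (ltry 1).
  apply: probability_le1; apply: measurableI => //.
  by rewrite -[X in measurable X]setTI; apply: measurable_funP.
Qed.

End characterizations.

Theorem theorem1 (R : realType) (disp : measure_display)
    (T : measurableType disp) (P : probability T R)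
    (d : nat) (hd : (0 < d)%N)
    (X : 'I_d -> {RV P >-> R}) (Y : {RV P >-> R})
    (hX : forall i, continuous (cdf (X i))) (hY : continuous (cdf Y))
    (A : d.+1.-tuple R -> R) (hA : copula A) (hXYA : connecting_copula X Y A)
    (mu : probability (d.-tuple R) R)
    (hmu : copula_measure (first_marginal A) mu)
    (K : R.-pker (d.-tuple R) ~> R) (hK : markov_kernel_of A mu K) :
  (completely_dependent X Y <->
   {in `[0, 1] &, psi mu K =2 comonotonicity_copula}) /\
  ((independent X Y <-> {in `[0, 1] &, psi mu K =2 independence_copula}) /\
   ({in `[0, 1] &, psi mu K =2 independence_copula} <->
    {in `[0, 1], diagonal_section (psi mu K) =1
                 diagonal_section independence_copula})).
Proof.
have dep_psi := completely_dependent_psi hA hXYA hmu hK.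
have psi_dep := psi_completely_dependent hA hXYA hmu hK.
have ind_psi := independent_psi hA hXYA hmu hK.
have diag_ind := diagonal_psi_independent hA hXYA hmu hK.
have psi_diag : {in `[0, 1] &, psi mu K =2 independence_copula} ->
    {in `[0, 1], diagonal_section (psi mu K) =1
                 diagonal_section independence_copula}.
  by move=> psiPi t t01; exact: psiPi.
split; first by split.
split; split => //.
- by move=> /psi_diag/diag_ind.
- by move=> /diag_ind/ind_psi.
Qed.
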